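(* There exists an absolute constant $C_B>0$ such that the following holds. Let $n\ge 1$, let $f:\{-1,1\}^n\to\{-1,1\}$ be non-constant with $\mathbb{E}f\le 0$, let $A=\{x\in\{-1,1\}^n: f(x)=1\}$ (so $\mu(A)\le 1/2$), and let $$r_{\mathrm{Iso}}=\frac{2\mu(A)\log_2\frac{1}{\mu(A)}}{\sum_{i=1}^n\mathrm{Inf}_i(f)}.$$ Then there exists a constant $c_{\mathrm{Iso}}\ge\dfrac{r_{\mathrm{Iso}}}{2C_B\log\left(\frac{2C_B}{r_{\mathrm{Iso}}}\right)}$, depending only on $r_{\mathrm{Iso}}$, such that $$\mu(\partial A)\ge c_{\mathrm{Iso}}\,\mu(A).$$
   Context: $\mu$ is the uniform probability measure on $\{-1,1\}^n$ and $\mathbb{E}$ is expectation with respect to $\mu$. $y^{\oplus i}$ is $y$ with the $i$-th coordinate flipped. $\mathrm{Inf}_i(f)=\mu(\{y: f(y)\ne f(y^{\oplus i})\})$. $\partial A$ denotes the inner vertex boundary of $A$, i.e. $\partial A=\{y\in A:\exists i,\ y^{\oplus i}\notin A\}=\{y: \exists i,\ f(y)=1,\ f(y^{\oplus i})=-1\}$. $\log$ is the natural logarithm. In the paper, $C_B$ is an absolute constant for which every non-constant $f:\{-1,1\}^n\to\{-1,1\}$ satisfies $\mu(\partial^{\pm}f)\ge \frac{r}{C_B\log (C_B/r)}\mathrm{Var}(f)$ with $r=\mathrm{Var}(f)/\sum_i\frac{\mathrm{Inf}_i(f)}{1+\log(1/\mathrm{Inf}_i(f))}$ (terms with $\mathrm{Inf}_i(f)=0$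 read as $0$), where $\partial^+f=\{y: \exists i,\ f(y)=1,\ f(y^{\oplus i})=-1\}$ and $\partial^-f=\{y:\exists i,\ f(y)=-1,\ f(y^{\oplus i})=1\}$. *)

(* Defs.v *)
From HB Require Import structures.
From mathcomp Require Import all_boot all_order all_algebra.
From mathcomp Require Import reals exp.

Set Implicit Arguments.
Unset Strict Implicit.
Unset Printing Implicit Defensive.

Import Order.TTheory GRing.Theory Num.Theory.
Local Open Scope ring_scope.

(* The two-point set {-1,1} is encoded by [bool], with [true] standing for 1
   and [false] for -1; [spin] decodes it and negation of signs is [negb]. *)
Definition spin (R : realType) (b : bool) : R := if b then 1 else -1.

Definition cube (n : nat) : finType := {ffun 'I_n -> bool}.

Definition flip (n : nat) (i : 'I_n) (y : cube n) : cube n :=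
  [ffun j => if j == i then ~~ y j else y j].

Definition mu (R : realType) (n : nat) (S : {set cube n}) : R :=
  #|S|%:R / #|cube n|%:R.

Definition expectation (R : realType) (n : nat) (g : cube n -> R) : R :=
  \sum_(x : cube n) g x * mu R [set x].

Definition nonconstant (n : nat) (f : cube n -> bool) : Prop :=
  exists x y : cube n, f x <> f y.

Definition Inf (R : realType) (n : nat) (f : cube n -> bool) (i : 'I_n) : R :=
  mu R [set y | f y != f (flip i y)].

Definition inner_boundary (n : nat) (A : {set cube n}) : {set cube n} :=
  [set y in A | [exists i : 'I_n, flip i y \notin A]].

Definition log2 (R : realType) (x : R) : R := ln x / ln 2.

Definition positive_set (n : nat) (f : cube n -> bool) : {set cube n} :=
  [set x | f x == true].

Definition r_iso (R : realType) (n : nat) (f : cube n -> bool) : R :=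
  2 * mu R (positive_set f) * log2 (1 / mu R (positive_set f))
  / \sum_(i < n) Inf R f i.

(* Main.v *)
Require Import Defs.
From HB Require Import structures.
From mathcomp Require Import all_boot all_order all_algebra.
From mathcomp Require Import reals sequences exp.
From mathcomp Require Import ring lra.

Set Implicit Arguments.
Unset Strict Implicit.
Unset Printing Implicit Defensive.

Import Order.TTheory GRing.Theory Num.Theory.
Local Open Scope ring_scope.

(** Write [a] for the measure of [A = {f = 1}] and [h(x)] for the number of
    edges leaving [A] at a point [x] of [A], with [h = 0] off [A].  The sum of
    the influences is [2 E h], so [r_iso = a log2(1/a) / E h], while [h]
    vanishes outside the inner boundary.  By Cauchy-Schwarz,
    [(E sqrt h)^2 <= mu(boundary) * E h], hence everything follows from
    Talagrand's one-sided inequality [E sqrt h >= c a sqrt(log2(1/a))] for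
    [a <= 1/2]; with [c = 1/4] it gives [mu(boundary) >= (r_iso / 16) a].

    Talagrand's inequality is proved by induction on the dimension.  Splitting
    the cube along one coordinate reduces it, through the triangle inequality
    in the plane ([mean_hypot]), to finding a function [J] on [0,1] with
    [J 0 = J 1 = 0] and
      [2 J((a+b)/2) <= sqrt(J(a)^2 + (a-b)^2) + J(b)] for [b <= a].
    For small differences this says [J J'' >= -2].  Taking [x sqrt(log(1/x))]
    for [J] fails near [x = 1], so one uses instead the family
    [J_e(x) = x (1 - x^e) / (2 sqrt e)] with [0 < e <= 1] ([profile]), for
    which the two-point inequality ([profile_two_point]) only needs the
    Bernoulli inequality, and chooses [e] at the very end according to [a]:
    for [e = 1 / log2(1/a)] one has [a^e = 1/2] and
    [J_e(a) = a sqrt(log2(1/a)) / 4] ([profile_inv_log2]).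

    The constant [r / 16] has the required form: since the boundary is part of
    [A], the inequality just obtained forces [r <= 16], so for [C = 8 exp 1]
    the logarithm of [2 C / r] is at least 1 and [2 C log(2 C / r) >= 16]. *)

(** * Averages over the cube and the splitting of one coordinate *)

Definition mean (R : realType) (n : nat) (g : cube n -> R) : R :=
  (\sum_x g x) / #|cube n|%:R.

Definition extend (n : nat) (b : bool) (x : cube n) : cube n.+1 :=
  [ffun i => if unlift ord0 i is Some j then x j else b].

(** This is Talagrand's function [h_A] for [A = {f = true}], the number of edges
    of the outgoing boundary of [A] at [x]. *)
Definition outdeg (n : nat) (f : cube n -> bool) (x : cube n) : nat :=
  \sum_(i < n) (f x && ~~ f (flip i x)).

Lemma card_cube_gt0 (n : nat) : (0 < #|cube n|)%N.
Proof. by apply/card_gt0P; exists [ffun=> true]. Qed.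

Lemma card_cubeS (n : nat) : #|cube n.+1| = (2 * #|cube n|)%N.
Proof. by rewrite !card_ffun !card_ord card_bool expnS. Qed.

Lemma flipK (n : nat) (i : 'I_n) : involutive (flip i).
Proof.
by move=> x; apply/ffunP=> j; rewrite !ffunE; case: eqP => // _; rewrite negbK.
Qed.

Lemma flip_extend0 (n : nat) (b : bool) (x : cube n) :
  flip ord0 (extend b x) = extend (~~ b) x.
Proof.
apply/ffunP=> i; rewrite !ffunE; case: (unliftP ord0 i) => [j|] ->.
  by rewrite eq_sym eq_liftF.
by rewrite eqxx.
Qed.

Lemma flip_extend_lift (n : nat) (b : bool) (i : 'I_n) (x : cube n) :
  flip (lift ord0 i) (extend b x) = extend b (flip i x).
Proof.
apply/ffunP=> k; rewrite !ffunE; case: (unliftP ord0 k) => [j|] ->.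
  by rewrite (inj_eq lift_inj) ffunE.
by rewrite eq_liftF.
Qed.

Lemma sum_cubeS (R : realType) (n : nat) (g : cube n.+1 -> R) :
  \sum_x g x = \sum_(x : cube n) g (extend true x)
             + \sum_(x : cube n) g (extend false x).
Proof.
pose h (p : bool * cube n) := extend p.1 p.2.
have hbij : bijective h.
  exists (fun z : cube n.+1 => (z ord0, [ffun j => z (lift ord0 j)])).
    move=> [b x]; rewrite /h /=; congr pair; first by rewrite ffunE unlift_none.
    by apply/ffunP=> j; rewrite !ffunE liftK.
  move=> z; apply/ffunP=> i; rewrite ffunE /=.
  by case: unliftP => [j|] -> //; rewrite ffunE.
rewrite (reindex h) /=; last exact: onW_bij.
by rewrite -(pair_bigA _ (fun b x => g (extend b x))) big_bool.
Qed.

Lemma mean_cubeS (R : realType) (n : nat) (g : cube n.+1 -> R) :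
  mean g = (mean (g \o extend true) + mean (g \o extend false)) / 2.
Proof.
have N0 : #|cube n|%:R != 0 :> R by rewrite pnatr_eq0 -lt0n card_cube_gt0.
by rewrite /mean sum_cubeS card_cubeS natrM /=; field.
Qed.

Lemma ler_mean (R : realType) (n : nat) (g h : cube n -> R) :
  (forall x, g x <= h x) -> mean g <= mean h.
Proof.
by move=> le_gh; rewrite ler_wpM2r ?invr_ge0 ?ler0n // ler_sum.
Qed.

Lemma meanZ (R : realType) (n : nat) (c : R) (g : cube n -> R) :
  mean (fun x => c * g x) = c * mean g.
Proof. by rewrite /mean -mulr_sumr mulrA. Qed.

Lemma meanD (R : realType) (n : nat) (g h : cube n -> R) :
  mean (fun x => g x + h x) = mean g + mean h.
Proof. by rewrite /mean big_split mulrDl. Qed.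

Lemma mean_set (R : realType) (n : nat) (S : {set cube n}) :
  mean (fun x => (x \in S)%:R) = mu R S.
Proof.
rewrite /mean /mu -(sum1_card (mem S)) natr_sum [in RHS]big_mkcond; congr (_ / _).
by apply: eq_bigr => x _; case: (x \in S).
Qed.

Lemma outdeg_extend (n : nat) (f : cube n.+1 -> bool) (b : bool) (x : cube n) :
  outdeg f (extend b x)
  = ((f (extend b x) && ~~ f (extend (~~ b) x)) + outdeg (f \o extend b) x)%N.
Proof.
rewrite /outdeg big_ord_recl flip_extend0; congr addn.
by apply: eq_bigr => i _; rewrite flip_extend_lift.
Qed.

(** The triangle inequality for the plane vectors [(u x, v x)].  Instead of
    adding vectors one by one, each is projected on the direction of the mean
    vector [(mean u, mean v)], scaled here by its length [W]. *)
Lemma mean_hypot (R : realType) (n : nat) (u v : cube n -> R) :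
  Num.sqrt (mean u ^+ 2 + mean v ^+ 2)
  <= mean (fun x => Num.sqrt (u x ^+ 2 + v x ^+ 2)).
Proof.
set U := mean u; set V := mean v; set W := Num.sqrt _.
have W2 : W ^+ 2 = U ^+ 2 + V ^+ 2 by rewrite sqr_sqrtr ?addr_ge0 ?sqr_ge0.
have [W0|W0] := eqVneq W 0.
  rewrite W0 divr_ge0 ?ler0n // sumr_ge0 // => x _; exact: sqrtr_ge0.
have Wpos : 0 < W by rewrite lt_def W0 sqrtr_ge0.
rewrite -(ler_pM2l Wpos) -expr2 W2 !expr2 -/U -/V -!meanZ -meanD.
apply: ler_mean => x; set a := u x; set b := v x.
apply: le_trans (ler_norm _) _.
rewrite -ler_sqr ?nnegrE ?normr_ge0 ?mulr_ge0 ?sqrtr_ge0 //.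
rewrite real_normK ?num_real // exprMn W2 sqr_sqrtr ?addr_ge0 ?sqr_ge0 //.
have := sqr_ge0 (U * b - V * a); nra.
Qed.

(** * The two-point inequality *)

(** Bernoulli's inequality, i.e. the concavity of [x |-> x ^ e], with the
    tangent taken at [m].  With [x / m = expR L] it is the convexity of [expR]
    on the segment from [0] to [L], which comes from the tangent line of [expR]
    at the intermediate point [e * L]. *)
Lemma powR_tangent (R : realType) (e m x : R) :
  0 < e <= 1 -> 0 < m -> 0 <= x ->
  x `^ e <= m `^ e * (1 + e * ((x - m) / m)).
Proof.
move=> /andP[e0 e1] m0 x0.
have [->|xn0] := eqVneq x 0.
  rewrite powR0 ?gt_eqF // mulr_ge0 ?powR_ge0 //.
  by rewrite sub0r mulNr divff ?gt_eqF //; lra.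
have xpos : 0 < x by rewrite lt_def xn0.
pose L := ln (x / m).
have xmE : x / m = expR L by rewrite lnK // posrE divr_gt0.
have -> : x = m * (x / m) by field; rewrite gt_eqF.
rewrite powRM ?divr_ge0 ?(ltW m0) // ler_wpM2l ?powR_ge0 //.
have -> : (m * (x / m) - m) / m = x / m - 1 by field; rewrite gt_eqF.
rewrite /powR xmE gt_eqF ?expR_gt0 // expRK.
set p := expR (e * L).
have p0 : 0 < p by apply: expR_gt0.
have E1 : expR L = p * expR ((1 - e) * L) by rewrite -expRD; congr expR; ring.
have E2 : 1 = p * expR (- (e * L)) by rewrite -expRD subrr expR0.
have B1 := expR_ge1Dx ((1 - e) * L).
have B2 := expR_ge1Dx (- (e * L)).
have C1 : p * (1 + (1 - e) * L) <= expR L by rewrite E1 ler_wpM2l // ltW.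
have C2 : p * (1 + - (e * L)) <= 1 by rewrite {2}E2 ler_wpM2l // ltW.
have D1 : e * (p * (1 + (1 - e) * L)) <= e * expR L by rewrite ler_wpM2l // ltW.
have D2 : (1 - e) * (p * (1 + - (e * L))) <= (1 - e) * 1.
  by rewrite ler_wpM2l // subr_ge0.
lra.
Qed.

(** These functions satisfy [J * J'' >= - 1/2] uniformly in [e], and their upper
    envelope over [0 < e <= 1] is of order [x * sqrt (log (1 / x))] for
    [x <= 1/2]. *)
Definition profile (R : realType) (e x : R) : R :=
  x * (1 - x `^ e) / (2 * Num.sqrt e).

Lemma powR_le1 (R : realType) (e x : R) : 0 <= e -> 0 <= x <= 1 -> x `^ e <= 1.
Proof.
move=> e0 /andP[x0 x1]; have <- : 1 `^ e = 1 by rewrite powR1.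
by rewrite ge0_ler_powR // nnegrE // ler01.
Qed.

(** Put [w = (a - b) / (a + b)], so that [a = m (1 + w)] and [b = m (1 - w)].
    The two Bernoulli bounds at [m] add up to a concavity defect
    [2 J(m) - J(a) - J(b)] of at most [D = sqrt e * m ^ e * m * w ^ 2], because
    the terms linear in [w] cancel.  It remains to see that
    [(J(a) + D) ^ 2 <= J(a) ^ 2 + (a - b) ^ 2]; here [(a - b) ^ 2] is
    [4 (m w) ^ 2], and the terms [2 J(a) D] and [D ^ 2] use up at most
    [2 (m w) ^ 2] and [(m w) ^ 2]. *)
Lemma profile_two_point (R : realType) (e a b : R) :
  0 < e <= 1 -> 0 <= b <= a -> a <= 1 ->
  profile e ((a + b) / 2)
  <= (Num.sqrt (profile e a ^+ 2 + (a - b) ^+ 2) + profile e b) / 2.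
Proof.
move=> e01 /andP[b0 ba] a1; have /andP[e0 e1] := e01.
(* The tangent at [m] is available only if [m] is positive. *)
have [m0|m_neq0] := eqVneq ((a + b) / 2) 0.
  have -> : b = 0 by lra.
  have -> : a = 0 by lra.
  by rewrite addr0 mul0r /profile !mul0r addr0 divr_ge0 ?sqrtr_ge0.
set m := (a + b) / 2 in m_neq0 *.
have mpos : 0 < m by rewrite lt_def m_neq0 /m; lra.
pose w := (a - b) / 2 / m.
have w0 : 0 <= w by rewrite /w divr_ge0 ?(ltW mpos) //; lra.
have w1 : w <= 1 by rewrite /w ler_pdivrMr // mul1r /m; lra.
have mw : m * w = (a - b) / 2 by rewrite /w mulrC divfK.
have aE : a = m * (1 + w) by rewrite mulrDr mw /m; lra.
have bE : b = m * (1 - w) by rewrite mulrBr mw /m; lra.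
have m1 : m <= 1 by rewrite /m; lra.
have M1 : m `^ e <= 1 by rewrite powR_le1 ?(ltW mpos) // ltW.
have Pa := powR_tangent e01 mpos (le_trans b0 ba).
have Pb := powR_tangent e01 mpos b0.
have P1 : a `^ e <= 1 by rewrite powR_le1 ?(ltW e0) // (le_trans b0 ba).
have P0 : 0 <= a `^ e := powR_ge0 _ _.
have M0 : 0 <= m `^ e := powR_ge0 _ _.
have wa : (a - m) / m = w by rewrite aE; field.
have wb : (b - m) / m = - w by rewrite bE; field.
rewrite wa in Pa; rewrite wb in Pb.
rewrite /profile; set s := Num.sqrt e.
have spos : 0 < s by rewrite sqrtr_gt0.
have s_ge0 := ltW spos; have m_ge0 := ltW mpos; have a_ge0 := le_trans b0 ba.
have sE : e = s ^+ 2 by rewrite sqr_sqrtr // ltW.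
set P := a `^ e in Pa P0 P1 *; set Q := b `^ e in Pb *.
set M := m `^ e in Pa Pb M0 M1 *.
have abE : a + b = 2 * m by rewrite /m; lra.
clearbody P Q M s w m.
pose D := s * M * m * w ^+ 2.
have D0 : 0 <= D by rewrite !mulr_ge0 ?sqr_ge0.
have J0 : 0 <= a * (1 - P) / (2 * s).
  by rewrite divr_ge0 ?mulr_ge0 ?subr_ge0.
have defect : 2 * (m * (1 - M)) - a * (1 - P) - b * (1 - Q) <= 2 * s * D.
  have aP : a * P <= a * (M * (1 + e * w)) by rewrite ler_wpM2l.
  have bQ : b * Q <= b * (M * (1 + e * - w)) by rewrite ler_wpM2l.
  have -> : 2 * s * D = a * (M * (1 + e * w)) + b * (M * (1 + e * - w)) - 2 * m * M.
    by rewrite /D aE bE sE; ring.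
  lra.
have root : a * (1 - P) / (2 * s) + D
            <= Num.sqrt ((a * (1 - P) / (2 * s)) ^+ 2 + (a - b) ^+ 2).
  rewrite -ler_sqr ?nnegrE ?sqrtr_ge0 ?addr_ge0 //.
  rewrite sqr_sqrtr ?addr_ge0 ?sqr_ge0 //.
  have cross : 2 * (a * (1 - P) / (2 * s)) * D <= 2 * (m * w) ^+ 2.
    have -> : 2 * (a * (1 - P) / (2 * s)) * D
              = ((1 + w) * (1 - P) * M) * (m * w) ^+ 2.
      by rewrite /D {1}aE; field; rewrite gt_eqF.
    rewrite ler_wpM2r ?sqr_ge0 //.
    apply: le_trans (_ : 2 * 1 * 1 <= _); last by rewrite !mulr1.
    by rewrite !ler_pM ?mulr_ge0 ?subr_ge0 ?addr_ge0 //; lra.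
  have square : D ^+ 2 <= (m * w) ^+ 2.
    rewrite ler_sqr ?nnegrE // ?mulr_ge0 //.
    have -> : D = (s * M * w) * (m * w) by rewrite /D; ring.
    rewrite ler_piMl ?mulr_ge0 //.
    have s1 : s <= 1 by rewrite -(@expr_le1 _ 2) // -sE.
    by rewrite !mulr_ile1 ?mulr_ge0.
  have aBb : a - b = 2 * (m * w) by rewrite aE bE; ring.
  rewrite aBb; have := sqr_ge0 (m * w); lra.
have defect' : 2 * (m * (1 - M) / (2 * s)) - a * (1 - P) / (2 * s)
     - b * (1 - Q) / (2 * s) <= D.
  have s2 : 0 < 2 * s by rewrite mulr_gt0.
  by rewrite mulrA -!mulrBl ler_pdivrMr // mulrC [D * _]mulrC mulrC.
lra.
Qed.

(** * Talagrand's one-sided inequality *)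

Lemma mean_indicator01 (R : realType) (n : nat) (f : cube n -> bool) :
  0 <= mean (fun x => (f x)%:R : R) <= 1.
Proof.
have N0 : 0 < #|cube n|%:R :> R by rewrite ltr0n card_cube_gt0.
rewrite divr_ge0 ?ler0n ?sumr_ge0 //= ler_pdivrMr // mul1r -natr_sum ler_nat.
by rewrite -sum1_card leq_sum // => x _; case: (f x).
Qed.

Lemma mean_cube0 (R : realType) (g : cube 0 -> R) (x : cube 0) : mean g = g x.
Proof.
have eqx y : y = x by apply/ffunP=> [[]].
rewrite /mean (eq_bigr (fun=> g x)) => [|y _]; last by rewrite (eqx y).
by rewrite sumr_const -[_ *+ _]mulr_natr mulfK // pnatr_eq0 -lt0n card_cube_gt0.
Qed.

Lemma profile0 (R : realType) (e : R) : profile e 0 = 0.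
Proof. by rewrite /profile !mul0r. Qed.

Lemma profile1 (R : realType) (e : R) : profile e 1 = 0.
Proof. by rewrite /profile powR1 subrr mulr0 mul0r. Qed.

Lemma profile_ge0 (R : realType) (e x : R) :
  0 <= e -> 0 <= x <= 1 -> 0 <= profile e x.
Proof.
move=> e0 x01; have /andP[x0 _] := x01.
by rewrite divr_ge0 ?mulr_ge0 ?subr_ge0 ?powR_le1 ?sqrtr_ge0.
Qed.

(** On the half with the larger share of [A], passing to the whole cube adds to
    the out-degree the indicator [v] of the points that leave [A] in the split
    direction.  Their measure is at least the difference [d] of the shares, and
    [mean_hypot] combines it with the bound [J] that holds inside the half. *)
Lemma half_cube_bound (R : realType) (n : nat) (f : cube n.+1 -> bool)
    (b : bool) (J d : R) :
  0 <= J <= mean (fun x => Num.sqrt (outdeg (f \o extend b) x)%:R) ->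
  0 <= d -> d <= mean (fun x => (f (extend b x))%:R)
                - mean (fun x => (f (extend (~~ b) x))%:R) ->
  Num.sqrt (J ^+ 2 + d ^+ 2)
  <= mean (fun x => Num.sqrt (outdeg f (extend b x))%:R).
Proof.
move=> /andP[J0 leJ] d0 led.
pose v x : R := (f (extend b x) && ~~ f (extend (~~ b) x))%:R.
have lev : d <= mean v.
  apply: le_trans led _; rewrite lerBlDr -meanD; apply: ler_mean => x.
  by rewrite /v; case: (f (extend b x)); case: (f _);
     rewrite ?addr0 ?add0r ?lexx ?ler01.
pose u x : R := Num.sqrt (outdeg (f \o extend b) x)%:R.
have -> : mean (fun x => Num.sqrt (outdeg f (extend b x))%:R)
        = mean (fun x => Num.sqrt (u x ^+ 2 + v x ^+ 2)).
  rewrite /mean; congr (_ / _); apply: eq_bigr => x _.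
  rewrite sqr_sqrtr ?ler0n // outdeg_extend natrD addrC /v.
  by case: (_ && _); rewrite ?expr1n ?expr0n.
apply: le_trans (mean_hypot u v).
by rewrite ler_wsqrtr // lerD // ler_sqr ?nnegrE // (le_trans _ leJ, le_trans d0 lev).
Qed.

(** The half with the larger share pays for the difference of the shares through
    [half_cube_bound], the other half contributes only its own induction
    hypothesis, and [profile_two_point] is exactly what recombines them. *)
Theorem talagrand_one_sided (R : realType) (e : R) (n : nat)
    (f : cube n -> bool) :
  0 < e <= 1 ->
  profile e (mean (fun x => (f x)%:R))
  <= mean (fun x => Num.sqrt (outdeg f x)%:R).
Proof.
move=> e01; have /andP[e0 _] := e01.
elim: n f => [|n IHn] f.
  rewrite !(mean_cube0 _ [ffun=> true]).
  by case: (f _); rewrite ?profile0 ?profile1 sqrtr_ge0.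
pose a b : R := mean (fun x => (f (extend b x))%:R).
have a01 b : 0 <= a b <= 1 by apply: mean_indicator01.
pose s b : R := mean (fun x => Num.sqrt (outdeg f (extend b x))%:R).
have J b : 0 <= profile e (a b)
             <= mean (fun x => Num.sqrt (outdeg (f \o extend b) x)%:R).
  by rewrite profile_ge0 ?(ltW e0) //= (IHn (f \o extend b)).
have weak b : profile e (a b) <= s b.
  have /andP[_ h] := J b; apply: le_trans h _; apply: ler_mean => x.
  by rewrite ler_wsqrtr // ler_nat outdeg_extend leq_addl.
have split b : a (~~ b) <= a b ->
    profile e ((a b + a (~~ b)) / 2) <= (s b + s (~~ b)) / 2.
  move=> le_a; have /andP[a0 _] := a01 (~~ b); have /andP[_ a1] := a01 b.
  apply: le_trans (profile_two_point e01 _ a1) _; first by rewrite a0.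
  rewrite ler_pM2r ?invr_gt0 // lerD // half_cube_bound // subr_ge0 //.
rewrite !mean_cubeS -[mean (_ \o extend true)]/(a true)
  -[mean (_ \o extend false)]/(a false).
rewrite -[mean (_ \o extend true)]/(s true) -[mean (_ \o extend false)]/(s false).
have [le_a|/ltW le_a] := leP (a false) (a true); first exact: split true le_a.
by rewrite addrC [s true + _]addrC; apply: split false le_a.
Qed.

(** * From Talagrand's inequality to the vertex boundary *)

(** Cauchy-Schwarz for [sqrt g] and the indicator of [S], obtained by averaging
    [(B * sqrt (g x) - M) ^ 2 >= 0] over [S], with [B = mu S] and
    [M = mean (sqrt g)]. *)
Lemma mean_sqrt_support (R : realType) (n : nat) (g : cube n -> R)
    (S : {set cube n}) :
  (forall x, 0 <= g x) -> (forall x, x \notin S -> g x = 0) ->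
  mean (fun x => Num.sqrt (g x)) ^+ 2 <= mu R S * mean g.
Proof.
move=> g0 gS; set M := mean _; set T := mean g; set B := mu R S.
have [S0|[x0 Sx0]] := set_0Vmem S.
  have M0 : M = 0.
    by rewrite /M /mean big1 ?mul0r // => x _; rewrite gS ?S0 ?inE // sqrtr0.
  by rewrite M0 expr0n mulr_ge0 ?divr_ge0 ?ler0n ?sumr_ge0.
have Bpos : 0 < B.
  rewrite divr_gt0 ?ltr0n ?card_cube_gt0 //.
  by apply/card_gt0P; exists x0.
have : mean (fun x => 2 * B * M * Num.sqrt (g x))
       <= mean (fun x => B ^+ 2 * g x + M ^+ 2 * (x \in S)%:R).
  apply: ler_mean => x; have [Sx|nSx] := boolP (x \in S); last first.
    by rewrite gS // sqrtr0 !mulr0 addr0.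
  have gE := sqr_sqrtr (g0 x); set y : R := Num.sqrt (g x) in gE *.
  by have := sqr_ge0 (B * y - M); rewrite -gE mulr1n; lra.
rewrite meanD !meanZ mean_set -/B -/M -/T.
have -> : B ^+ 2 * T + M ^+ 2 * B = B * (B * T + M ^+ 2) by ring.
have -> : 2 * B * M * M = B * (M ^+ 2 + M ^+ 2) by ring.
by rewrite ler_pM2l // lerD2r.
Qed.

Lemma outdeg_inner_boundary (n : nat) (f : cube n -> bool) (x : cube n) :
  x \notin inner_boundary (positive_set f) -> outdeg f x = 0%N.
Proof.
rewrite !inE eqb_id negb_and => nbd; apply/eqP; rewrite sum_nat_eq0.
apply/forallP=> i /=; case: (f x) nbd => //=.
by rewrite negb_exists => /forallP/(_ i); rewrite inE eqb_id negbK => ->.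
Qed.

(** Flipping coordinate [i] exchanges the two endpoints of an edge, so half of
    the points that are sensitive in direction [i] lie in [A]. *)
Lemma sum_Inf (R : realType) (n : nat) (f : cube n -> bool) :
  \sum_(i < n) Inf R f i = 2 * mean (fun x => (outdeg f x)%:R).
Proof.
pose out i x : R := (f x && ~~ f (flip i x))%:R.
have InfE i : Inf R f i = 2 * mean (out i).
  have flip_out : mean (out i) = mean (fun x => out i (flip i x)).
    by rewrite /mean (reindex_inj (inv_inj (flipK i))).
  rewrite mulr2n mulrDl mul1r {2}flip_out -meanD /Inf -mean_set /mean.
  congr (_ / _); apply: eq_bigr => x _; rewrite inE /out flipK.
  by case: (f x); case: (f _); rewrite ?addr0 ?add0r.
rewrite (eq_bigr _ (fun i _ => InfE i)) -mulr_sumr; congr (_ * _).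
rewrite /mean -mulr_suml exchange_big /=; congr (_ / _).
by apply: eq_bigr => x _; rewrite /outdeg natr_sum.
Qed.

Lemma mean_spin (R : realType) (n : nat) (f : cube n -> bool) :
  expectation (fun x => spin R (f x)) = 2 * mu R (positive_set f) - 1.
Proof.
have N0 : #|cube n|%:R != 0 :> R by rewrite pnatr_eq0 -lt0n card_cube_gt0.
have -> : expectation (fun x => spin R (f x)) = mean (fun x => spin R (f x)).
  rewrite /expectation /mean mulr_suml; apply: eq_bigr => x _.
  by rewrite /mu cards1 mul1r.
have -> : mean (fun x => spin R (f x))
        = mean (fun x => 2 * (x \in positive_set f)%:R + -1).
  rewrite /mean; congr (_ / _); apply: eq_bigr => x _; rewrite inE /spin.
  by case: (f x) => /=; ring.
rewrite meanD meanZ mean_set; congr (_ + _).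
by rewrite /mean sumr_const -[(-1) *+ _]mulr_natr mulfK.
Qed.

(** With this exponent [a ^ e = 1/2], which balances the factors [1 - a ^ e] and
    [1 / sqrt e] of the profile; the bound [a <= 1/2] is what makes [e <= 1]. *)
Lemma profile_inv_log2 (R : realType) (a : R) :
  0 < a <= 2^-1 ->
  let e := (log2 (1 / a))^-1 in
  (0 < e <= 1) /\ profile e a ^+ 2 = a ^+ 2 * log2 (1 / a) / 16.
Proof.
move=> /andP[a0 a1] e.
have ln2 : 0 < ln 2 :> R by rewrite ln_gt0 // ltr1n.
have LE : log2 (1 / a) = - ln a / ln 2 by rewrite /log2 div1r lnV ?posrE.
have L1 : 1 <= log2 (1 / a).
  rewrite LE ler_pdivlMr // mul1r lerNr -lnV ?posrE //.
  by rewrite ler_ln ?posrE ?invr_gt0.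
have L0 : 0 < log2 (1 / a) := lt_le_trans ltr01 L1.
have e0 : 0 < e by rewrite invr_gt0.
split; first by rewrite e0 invf_le1.
have ae : a `^ e = 2^-1.
  rewrite /powR gt_eqF // /e LE invf_div mulrAC.
  have -> : ln 2 * ln a / - ln a = - ln 2.
    have := LE; have := L0; rewrite LE => /lt0r_neq0; rewrite mulf_eq0 oppr_eq0.
    by rewrite negb_or => /andP[lna _] _; field.
  by rewrite expRN lnK // posrE.
rewrite /profile ae exprMn exprVn [(2 * _) ^+ 2]exprMn sqr_sqrtr ?(ltW e0) //.
by rewrite /e; field; rewrite gt_eqF.
Qed.

Lemma boundary_ge_r_iso (R : realType) (n : nat) (f : cube n -> bool) :
  mu R (positive_set f) <= 2^-1 ->
  r_iso R f / 16 * mu R (positive_set f)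
  <= mu R (inner_boundary (positive_set f)).
Proof.
set A := positive_set f; set a := mu R A; set B := mu R _ => a_half.
have B0 : 0 <= B by rewrite divr_ge0.
have a_ge0 : 0 <= a by rewrite divr_ge0.
rewrite /r_iso sum_Inf -/A -/a; set T := mean _.
have [a0|a_neq0] := eqVneq a 0; first by rewrite a0 mulr0.
have apos : 0 < a by rewrite lt_def a_neq0.
have [|e01] := @profile_inv_log2 R a; first by rewrite apos.
set L := log2 _ => profE.
have T_ge0 : 0 <= T by rewrite divr_ge0 ?sumr_ge0.
(* Without outgoing edges the quotient [r_iso] is [0], as division by [0] is. *)
have [T0|T_neq0] := eqVneq T 0; first by rewrite T0 mulr0 invr0 mulr0 !mul0r.
have Tpos : 0 < T by rewrite lt_def T_neq0.
have meanA : mean (fun x => (f x)%:R) = a :> R.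
  rewrite /a -mean_set /mean; congr (_ / _); apply: eq_bigr => x _.
  by rewrite inE eqb_id.
have BT : a ^+ 2 * L / 16 <= B * T.
  rewrite -profE.
  apply: le_trans (_ : mean (fun x => Num.sqrt (outdeg f x)%:R) ^+ 2 <= _).
    have lower := talagrand_one_sided f e01; rewrite meanA in lower.
    have /andP[e0 _] := e01.
    rewrite ler_sqr ?nnegrE ?(le_trans _ lower) // profile_ge0 ?(ltW e0) //.
    1,2: by rewrite a_ge0 (le_trans a_half) // invf_le1 // ler1n.
  apply: mean_sqrt_support => x //.
  by move/outdeg_inner_boundary ->.
have -> : 2 * a * L / (2 * T) / 16 * a = a ^+ 2 * L / 16 / T by field.
by rewrite ler_pdivrMr.
Qed.

Lemma r_iso_ge0 (R : realType) (n : nat) (f : cube n -> bool) :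
  0 <= r_iso R f.
Proof.
rewrite /r_iso; set a := mu R _.
have a_ge0 : 0 <= a by rewrite divr_ge0.
have a_le1 : a <= 1.
  by rewrite ler_pdivrMr ?ltr0n ?card_cube_gt0 // mul1r ler_nat max_card.
rewrite divr_ge0 ?sumr_ge0 // => [|i _]; last by rewrite divr_ge0.
have [->|a_neq0] := eqVneq a 0; first by rewrite mulr0 mul0r.
have a_gt0 : 0 < a by rewrite lt_def a_neq0.
apply: mulr_ge0; first by rewrite mulr_ge0.
rewrite divr_ge0 ?ln_ge0 ?ler1n //.
by rewrite div1r invf_ge1.
Qed.

Theorem corollary6 (R : realType) :
  exists C_B : R, 0 < C_B /\
  exists c_Iso : R -> R,
    forall (n : nat) (f : cube n -> bool),
      (1 <= n)%N ->
      nonconstant f ->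
      expectation (fun x => spin R (f x)) <= 0 ->
      let A := positive_set f in
      let r := r_iso R f in
      c_Iso r >= r / (2 * C_B * ln (2 * C_B / r)) /\
      mu R (inner_boundary A) >= c_Iso r * mu R A.
Proof.
have e_gt0 : 0 < expR 1 :> R by apply: expR_gt0.
have e_ge1 : 1 <= expR 1 :> R by rewrite -[leLHS]expR0 ler_expR.
exists (8 * expR 1); split; first by rewrite mulr_gt0.
exists (fun r => r / 16) => n f _ _; rewrite mean_spin subr_le0 => Ef A r.
have a_half : mu R A <= 2^-1 by rewrite -[leRHS]mul1r ler_pdivlMr // mulrC.
have bound := boundary_ge_r_iso a_half; split=> //.
have [r0|r_neq0] := eqVneq r 0; first by rewrite r0 !mul0r.
have r_gt0 : 0 < r by rewrite lt_def r_neq0 r_iso_ge0.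
have a_gt0 : 0 < mu R A.
  rewrite lt_def divr_ge0 // andbT; apply: contraTneq r_gt0 => a0.
  by rewrite /r /r_iso -/A a0 mulr0 !mul0r ltxx.
have r_le16 : r <= 16.
  rewrite -[leRHS]mul1r -ler_pdivrMr // -(ler_pM2r a_gt0) mul1r.
  apply: le_trans bound _.
  rewrite ler_pM2r ?invr_gt0 ?ltr0n ?card_cube_gt0 // ler_nat subset_leq_card //.
  by apply/subsetP=> x; rewrite !inE => /andP[].
have ln_ge1 : 1 <= ln (2 * (8 * expR 1) / r).
  have cr_gt0 : 0 < 2 * (8 * expR 1) / r by apply: divr_gt0 => //; rewrite !mulr_gt0.
  rewrite -ler_expR lnK ?posrE // ler_pdivlMr //.
  have : expR 1 * r <= expR 1 * 16 by rewrite ler_pM2l.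
  by lra.
have C_ge16 : 16 <= 2 * (8 * expR 1) * ln (2 * (8 * expR 1) / r).
  have : 1 <= expR 1 * ln (2 * (8 * expR 1) / r) by rewrite -[leLHS]mulr1 ler_pM.
  by lra.
by rewrite ler_pM2l // lef_pV2 ?posrE // (lt_le_trans _ C_ge16).
Qed.
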